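(* Let $p$ be a prime number, let $C$ be a commutative ring and $\lambda\in C$. Let $Ш_C(X)$ be the free Baxter algebra of weight $\lambda$ on $C[x]$, and let $S(p,I)\in C$ (for $I\in\mathcal{I}$, $|I|=p$) be the coefficients determined by $(1\otimes x)^p=\sum_{|I|=p}S(p,I)(1\otimes x^{\otimes I})$ in $Ш_C(X)$. (1) $p\mid S(p,I)$ for any $I\in\mathcal{I}$ with $|I|=p$ and $I\ne(p)$. (2) $p\mid S(p,k)$ for $1<k<p$, where $S(p,k)\in\mathbb{Z}$ is the Stirling number of the second kind. (3) $(1\otimes x)^p\equiv\lambda^{p-1}\otimes x^p\pmod p$ in $Ш_C(X)$. (4) For any Baxter $C$-algebra $(R,P)$ of weight $\lambda$ and any $a\in R$, $P(a)^p\equiv\lambda^{p-1}P(a^p)\pmod p$. (5) Let $C=\mathbb{F}_p$, let $\lambda\in\mathbb{F}_p$ satisfy $\lambda^{p-1}=\lambda$, and let $Ш_{\mathbb{F}_p}(\mathbb{F}_p)$ be the free Baxter algebra over $\mathbb{F}_p$ on $\mathbb{F}_p$ of weight $\lambda$. For $a\in Ш_{\mathbb{F}_p}(\mathbb{F}_p)$, we have $a^p=\lambda^{p-1}a$.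
   Context: Rings and algebras have an identity $1$. For an algebra $B$ and $a,b\in B$, $a\equiv b\pmod p$ means $a-b\in pB$; for elements of $C$, $p\mid c$ means $c\in pC$. A Baxter $C$-algebra of weight $\lambda\in C$ is a pair $(R,P)$ where $R$ is a $C$-algebra and $P:R\to R$ is a $C$-linear map with $P(x)P(y)=P(xP(y))+P(P(x)y)+\lambda P(xy)$ for all $x,y\in R$. For a commutative $C$-algebra $A$, the free Baxter algebra of weight $\lambda$ on $A$, written $Ш_C(A)$, is realized as the mixable shuffle Baxter algebra: as a $C$-module it is $\bigoplus_{n\ge1}A^{\otimes n}$ (tensor products over $C$); its multiplication $\diamond$ (written as juxtaposition) is the $C$-bilinear product given recursively by $a_0\diamond(b_0\otimes b_1\otimes\cdots\otimes b_n)=a_0b_0\otimes b_1\otimes\cdots\otimes b_n$, $(a_0\otimes a_1\otimes\cdots\otimes a_m)\diamond b_0=a_0b_0\otimes a_1\otimes\cdots\otimes a_m$, and, for $m,n\ge1$, $(a_0\otimes a_1\otimes\cdots\otimes a_m)\diamond(b_0\otimes b_1\otimes\cdots\otimes b_n)=a_0b_0\otimes\big((a_1\otimes\cdots\otimes a_m)\diamond(1\otimes b_1\otimes\cdots\otimes b_n)\big)+a_0b_0\otimes\big((1\otimes a_1\otimes\cdots\otimes a_m)\diamond(b_1\otimes\cdots\otimes b_n)\big)+\lambda\,a_0b_0\otimes\big((a_1\otimes\cdots\otimes a_m)\diamond(b_1\otimes\cdots\otimes b_n)\big)$ for $a_i,b_j\in A$; its Baxter operator is $P_A(a_1\otimes\cdots\otimes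 a_m)=1\otimes a_1\otimes\cdots\otimes a_m$. For $A=C[x]$ this algebra is denoted $Ш_C(X)$, $X=\{x\}$, with operator $P_X$. Let $\mathcal{I}=\{I=(i_1,\dots,i_k)\mid k\ge1,\ i_s\ge0\text{ integers}\}$; for $I=(i_1,\dots,i_k)$ put $|I|=i_1+\cdots+i_k$ and $x^{\otimes I}=x^{i_1}\otimes\cdots\otimes x^{i_k}$; $(p)$ is the one-term sequence. The elements $1\otimes x^{\otimes I}$ form a $C$-basis of $P_X(Ш_C(X))$, which is closed under multiplication, and $(1\otimes x)^p$ is a finite $C$-linear combination of those with $|I|=p$, so $S(p,I)$ is well defined. The Stirling numbers of the second kind $S(n,k)$ are defined by $t^n=\sum_{k=0}^nS(n,k)\,t(t-1)\cdots(t-k+1)$.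
   Formalization: In (5), ''λ ≠ 0 or a lies in the image of the Baxter operator'' is added, since the claim fails for λ = 0, a = 1; in (4), the Baxter algebra R is taken commutative, since the congruence fails for noncommutative R (e.g. p = 2, λ = 0). *)

(* Defs.v *)
From HB Require Import structures.
From mathcomp Require Import all_boot all_order all_algebra.
From mathcomp Require Import finmap boolp.

Set Implicit Arguments.
Unset Strict Implicit.
Unset Printing Implicit Defensive.

Import GRing.Theory.
Local Open Scope ring_scope.
Local Open Scope quotient_scope.

(* c \in p B *)
Definition dvdr (B : pzRingType) (p : nat) (c : B) : Prop :=
  exists d : B, c = p%:R * d.

Definition eqmodr (B : pzRingType) (p : nat) (a b : B) : Prop := dvdr p (a - b).

Section TensorPowers.
Variables (C : comNzRingType) (A : comAlgType C).

(* The pair (a0, [:: a1; ...; an]) stands for the nonempty sequence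
   (a0, a1, ..., an) of n.+1 elements of A. *)
Definition word : Type := (A * seq A)%type.
HB.instance Definition _ := Choice.on word.

(* A family of C-multilinear maps A^n -> V, one for each n >= 1. *)
Definition multilinear (V : lmodType C) (f : word -> V) : Prop :=
  (forall c a b s, f (c *: a + b, s) = c *: f (a, s) + f (b, s)) /\
  (forall a0 s t c a b,
     f (a0, s ++ (c *: a + b) :: t) =
     c *: f (a0, s ++ a :: t) + f (a0, s ++ b :: t)).

Definition fsum : Type := seq (C * word).
HB.instance Definition _ := Choice.on fsum.

Definition evalf (V : lmodType C) (f : word -> V) (l : fsum) : V :=
  \sum_(u <- l) u.1 *: f u.2.

(* Two formal C-linear combinations of words are identified when all
   multilinear maps agree on them, which is the congruence generated by the
   multilinearity relations: the quotient has the universal property of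
   the direct sum of the tensor powers of A (see tlift_pure and
   linear_tens_eq). *)
Definition tequiv (l l' : fsum) : bool :=
  `[< forall (V : lmodType C) (f : word -> V),
        multilinear f -> evalf f l = evalf f l' >].

Lemma tequiv_equiv : equiv_class_of tequiv.
Proof.
split=> [l|l l'|l2 l1 l3].
- by apply/asboolP.
- by apply/asboolP/asboolP => h V f mf; rewrite h.
- move=> /asboolP h1 /asboolP h2; apply/asboolP => V f mf.
  by rewrite h1 ?h2.
Qed.

Canonical tequiv_rel := EquivRelPack tequiv_equiv.

(* The direct sum over n >= 1 of the n-th tensor powers of A over C. *)
Definition tens : Type := {eq_quot tequiv}.
HB.instance Definition _ := Choice.on tens.
HB.instance Definition _ := EqQuotient.on tens.

Definition tpi (l : fsum) : tens := \pi_tens l.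

Definition ev (V : lmodType C) (f : word -> V) (x : tens) : V :=
  evalf f (repr x).

Lemma ev_pi (V : lmodType C) (f : word -> V) l :
  multilinear f -> ev f (tpi l) = evalf f l.
Proof.
move=> mf; rewrite /ev /tpi; case: piP => l' /eqmodP /asboolP h.
by rewrite h.
Qed.

Lemma tens_eq (x y : tens) :
  (forall (V : lmodType C) (f : word -> V),
     multilinear f -> ev f x = ev f y) -> x = y.
Proof.
move=> h; rewrite -[x]reprK -[y]reprK; apply/eqmodP/asboolP => V f mf.
exact: h.
Qed.

Definition tens0 : tens := tpi [::].
Definition tens_add (x y : tens) : tens := tpi (repr x ++ repr y).
Definition tens_scale (c : C) (x : tens) : tens :=
  tpi [seq (c * u.1, u.2) | u <- repr x].
Definition tens_opp (x : tens) : tens := tens_scale (-1) x.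

(* The pure tensor a0 (x) a1 (x) ... (x) an. *)
Definition pure (w : word) : tens := tpi [:: (1, w)].

Section Ev.
Variables (V : lmodType C) (f : word -> V) (mf : multilinear f).

Lemma ev0 : ev f tens0 = 0.
Proof. by rewrite ev_pi // /evalf big_nil. Qed.

Lemma evD x y : ev f (tens_add x y) = ev f x + ev f y.
Proof. by rewrite ev_pi // /evalf big_cat. Qed.

Lemma evZ c x : ev f (tens_scale c x) = c *: ev f x.
Proof.
rewrite ev_pi // /evalf big_map scaler_sumr.
by apply: eq_bigr => u _; rewrite scalerA.
Qed.

Lemma ev_pure w : ev f (pure w) = f w.
Proof. by rewrite ev_pi // /evalf big_seq1 scale1r. Qed.

End Ev.

Lemma tens_addA : associative tens_add.
Proof. by move=> x y z; apply: tens_eq => V f mf; rewrite !evD // addrA. Qed.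

Lemma tens_addC : commutative tens_add.
Proof. by move=> x y; apply: tens_eq => V f mf; rewrite !evD // addrC. Qed.

Lemma tens_add0 : left_id tens0 tens_add.
Proof. by move=> x; apply: tens_eq => V f mf; rewrite !evD // ev0 // add0r. Qed.

Lemma tens_addN : left_inverse tens0 tens_opp tens_add.
Proof.
move=> x; apply: tens_eq => V f mf.
by rewrite !evD // ev0 // evZ // scaleN1r addNr.
Qed.

HB.instance Definition _ :=
  GRing.isZmodule.Build tens tens_addA tens_addC tens_add0 tens_addN.

Lemma tens_scaleA a b v : tens_scale a (tens_scale b v) = tens_scale (a * b) v.
Proof. by apply: tens_eq => V f mf; rewrite !evZ // scalerA. Qed.

Lemma tens_scale1 : left_id 1 tens_scale.
Proof. by move=> x; apply: tens_eq => V f mf; rewrite !evZ // scale1r. Qed.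

Lemma tens_scaleDr : right_distributive tens_scale +%R.
Proof.
move=> c x y; apply: tens_eq => V f mf.
by rewrite evZ // !evD // !evZ // scalerDr.
Qed.

Lemma tens_scaleDl v : {morph tens_scale^~ v : a b / a + b}.
Proof.
move=> a b; apply: tens_eq => V f mf.
by rewrite evD // !evZ // scalerDl.
Qed.

HB.instance Definition _ := GRing.Zmodule_isLmodule.Build C tens
  tens_scaleA tens_scale1 tens_scaleDr tens_scaleDl.

Lemma ev_linear (V : lmodType C) (f : word -> V) :
  multilinear f -> linear (ev f).
Proof.
by move=> mf c x y; rewrite [LHS](evD mf) [X in X + _](evZ mf).
Qed.

Lemma pure_multilinear : multilinear pure.
Proof.
split=> *; apply: tens_eq => V f mf; rewrite [RHS](evD mf) [X in _ = X + _](evZ mf);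
  rewrite !ev_pure //; case: mf => h1 h2; [exact: h1|exact: h2].
Qed.

(* The linear map tens -> V induced by a multilinear f. *)
Definition tlift (V : lmodType C) (f : word -> V) (mf : multilinear f) :
  tens -> V := ev f.

HB.instance Definition _ (V : lmodType C) (f : word -> V)
  (mf : multilinear f) :=
  GRing.isLinear.Build C tens V *:%R (tlift mf) (ev_linear mf).

Lemma tlift_pure (V : lmodType C) (f : word -> V) (mf : multilinear f) w :
  tlift mf (pure w) = f w.
Proof. exact: ev_pure. Qed.

Lemma tens_ind (Q : tens -> Prop) :
  (forall c w x, Q x -> Q (c *: pure w + x)) -> Q 0 -> forall x, Q x.
Proof.
move=> h Q0 x; rewrite -[x]reprK -/(tpi (repr x)); elim: (repr x) => [|[c w] l IH].
  exact: Q0.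
suff -> : tpi ((c, w) :: l) = c *: pure w + tpi l by exact: h.
apply: tens_eq => V f mf.
rewrite [RHS](evD mf) [X in _ = X + _](evZ mf) ev_pure // !ev_pi //.
by rewrite /evalf big_cons.
Qed.

Lemma linear_tens_eq (V : lmodType C) (f g : tens -> V) :
  linear f -> linear g -> (forall w, f (pure w) = g (pure w)) -> f =1 g.
Proof.
move=> lf lg h; apply: tens_ind => [c w x e|].
  by rewrite lf lg h e.
pose f' : {linear _ -> _} := HB.pack f (GRing.isLinear.Build _ _ _ _ f lf).
pose g' : {linear _ -> _} := HB.pack g (GRing.isLinear.Build _ _ _ _ g lg).
by rewrite -[f]/(f' : _ -> _) -[g]/(g' : _ -> _) !linear0.
Qed.

Lemma cons_multilinear a : multilinear (fun w => pure (a, w.1 :: w.2)).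
Proof.
case: pure_multilinear => _ h; split=> [c x y s|a0 s t c x y] /=.
  exact: (h _ [::]).
exact: (h _ (_ :: _)).
Qed.

(* a0 (x) _, sending a1 (x) ... (x) an to a0 (x) a1 (x) ... (x) an. *)
Definition tcons (a : A) : tens -> tens := tlift (cons_multilinear a).

HB.instance Definition _ (a : A) := GRing.Linear.on (tcons a).

Lemma tcons_pure a w : tcons a (pure w) = pure (a, w.1 :: w.2).
Proof. exact: tlift_pure. Qed.

Lemma tcons_linearl x : linear (tcons^~ x).
Proof.
move=> c a b; move: x; apply: linear_tens_eq => [d x y|d x y|w].
- exact: linearP.
- rewrite (linearP (tcons a)) (linearP (tcons b)) !scalerDr !scalerA.
  by rewrite [d * c]mulrC addrACA.
- rewrite !tcons_pure; case: pure_multilinear => h _; exact: h.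
Qed.


Section Diamond.
Variable lam : C.

(* The recursion of the mixable shuffle product; n only bounds the recursion
   depth and is irrelevant once it is large enough (dia_fuel). The recursion
   without this bound is msh_mul_ten1, msh_mul_ten2 and msh_mul_ten below. *)
Fixpoint dia (n : nat) (w w' : word) : tens :=
  match w, w' with
  | (a0, [::]), (b0, t) => pure (a0 * b0, t)
  | (a0, s), (b0, [::]) => pure (a0 * b0, s)
  | (a0, a1 :: s), (b0, b1 :: t) =>
    if n is m.+1 then
      tcons (a0 * b0) (dia m (a1, s) (1, b1 :: t) + dia m (1, a1 :: s) (b1, t)
                       + lam *: dia m (a1, s) (b1, t))
    else 0
  end.

Definition diamond_word (w w' : word) : tens :=
  dia (size w.2 + size w'.2) w w'.

Lemma diaC n w w' : dia n w w' = dia n w' w.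
Proof.
elim: n w w' => [|n IH] [a [|a1 s]] [b [|b1 t]] //=; rewrite [b * a]mulrC //.
congr (tcons _ (_ + _)); last by rewrite IH.
by rewrite addrC; congr (_ + _).
Qed.

Lemma dia_multilinear n w' : multilinear (dia n ^~ w').
Proof.
have [ph pt] := pure_multilinear.
elim: n w' => [|n IH] [b t].
  split=> [c x y [|a1 s]|a0 s r c x y] /=; case: t => [|b1 t] //=;
    rewrite ?mulrDl ?scalerAl ?scaler0 ?addr0 -?scalerAl ?ph ?pt //;
    by case: s => *; rewrite ?scaler0 ?addr0 ?pt //; rewrite -?cat_cons pt.
have hd c x y s u : dia n (c *: x + y, s) u = c *: dia n (x, s) u + dia n (y, s) u.
  by case: (IH u) => h _; exact: h.
have tl a0 c x y s r u : dia n (a0, s ++ (c *: x + y) :: r) u =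
   c *: dia n (a0, s ++ x :: r) u + dia n (a0, s ++ y :: r) u.
  by case: (IH u) => _ h; exact: h.
have sum3 c x1 x2 x3 y1 y2 y3 : (c *: x1 + y1) + (c *: x2 + y2)
   + lam *: (c *: x3 + y3) = c *: (x1 + x2 + lam *: x3) + (y1 + y2 + lam *: y3) :> tens.
  rewrite !scalerDr !scalerA [c * lam]mulrC.
  by rewrite [LHS](AC (2*2*2) (1*3*5*(2*4*6)))%AC.
split=> [c x y [|a1 s]|a0 [|a1 s] r c x y] /=; case: t => [|b1 t] //=.
- by rewrite mulrDl -scalerAl ph.
- by rewrite mulrDl -scalerAl ph.
- by rewrite mulrDl -scalerAl ph.
- by rewrite mulrDl -scalerAl tcons_linearl.
- exact: (pt _ [::]).
- rewrite !hd; have := tl 1 c x y [::] r; rewrite /= => ->.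
  by rewrite sum3 linearP.
- exact: (pt _ (_ :: _)).
- rewrite !tl; have := tl 1 c x y (a1 :: s) r; rewrite /= => ->.
  by rewrite sum3 linearP.
Qed.

Lemma dia_cons n a a1 s b b1 t :
  dia n.+1 (a, a1 :: s) (b, b1 :: t) =
  tcons (a * b) (dia n (a1, s) (1, b1 :: t) + dia n (1, a1 :: s) (b1, t)
                 + lam *: dia n (a1, s) (b1, t)).
Proof. by []. Qed.

Lemma dia_fuel n w w' :
  (size w.2 + size w'.2 <= n)%N -> dia n w w' = diamond_word w w'.
Proof.
rewrite /diamond_word; have [m] := ubnP (size w.2 + size w'.2).
elim: m n w w' => // m IH n [a [|a1 s]] [b [|b1 t]] lt_m; try by case: n.
case: n => [|n]; first by rewrite addSn.
have {}lt_m : ((size s + size t).+1 < m)%N by move: lt_m; rewrite /= addSn addnS.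
rewrite [size _]/= [size (_, _).2]/= addSn addnS ltnS !dia_cons => le_n.
have e k w1 w2 : (size w1.2 + size w2.2 <= (size s + size t).+1)%N ->
    ((size s + size t).+1 <= k)%N -> dia k w1 w2 = diamond_word w1 w2.
  move=> le1 le2; apply: IH; last exact: leq_trans le2.
  exact: leq_ltn_trans le1 lt_m.
by rewrite !e //= ?addnS ?addSn.
Qed.

Lemma diamond_word_multilinear w' : multilinear (diamond_word ^~ w').
Proof.
have h n := dia_multilinear n w'; split=> [c a b s|a0 s t c a b].
  by have [h1 _] := h (size s + size w'.2)%N; exact: h1.
have [_ h2] := h (size (s ++ a :: t) + size w'.2)%N.
have e x : diamond_word (a0, s ++ x :: t) w' =
  dia (size (s ++ a :: t) + size w'.2) (a0, s ++ x :: t) w'.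
  by rewrite dia_fuel //= !size_cat.
by rewrite !e h2.
Qed.

Lemma diamond_l_multilinear x :
  multilinear (fun w' => tlift (diamond_word_multilinear w') x).
Proof.
have C_ w w' : diamond_word w w' = diamond_word w' w.
  by rewrite /diamond_word addnC diaC.
split=> [c a b s|a0 s t c a b]; move: x; apply: linear_tens_eq => [d x y|d x y|w].
- exact: (linearP (tlift _)).
- rewrite !(linearP (tlift _)) !scalerDr !scalerA [d * c]mulrC.
  by rewrite addrACA.
- rewrite !tlift_pure ![diamond_word w _]C_; case: (diamond_word_multilinear w) => h _; exact: h.
- exact: (linearP (tlift _)).
- rewrite !(linearP (tlift _)) !scalerDr !scalerA [d * c]mulrC.
  by rewrite addrACA.
- rewrite !tlift_pure ![diamond_word w _]C_; case: (diamond_word_multilinear w) => _ h; exact: h.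
Qed.

(* The C-bilinear extension of diamond_word to sums of tensors. *)
Definition diamond (x y : tens) : tens := tlift (diamond_l_multilinear x) y.

Lemma diamond_pure w w' : diamond (pure w) (pure w') = diamond_word w w'.
Proof. by rewrite /diamond !tlift_pure. Qed.
End Diamond.
End TensorPowers.

(* The free Baxter algebra of weight lam on A, as the mixable shuffle algebra:
   the phantom parameter lam selects the product put on tens A. *)
Definition mshuffle (C : comNzRingType) (A : comAlgType C) (lam : C) : Type :=
  tens A.

Section MixableShuffle.
Variables (C : comNzRingType) (A : comAlgType C) (lam : C).
Local Notation Sha := (mshuffle A lam).

HB.instance Definition _ := GRing.Lmodule.copy Sha (tens A).

(* ten a0 [:: a1; ...; an] is a0 (x) a1 (x) ... (x) an. *)
Definition ten (a : A) (s : seq A) : Sha := pure (a, s).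

Definition otimes (a : A) : Sha -> Sha := tcons a.
HB.instance Definition _ (a : A) := GRing.Linear.on (otimes a).

Definition baxter_op : Sha -> Sha := otimes 1.
HB.instance Definition _ := GRing.Linear.on baxter_op.

Definition msh_mul (x y : Sha) : Sha := diamond lam x y.
Local Infix "<.>" := msh_mul (at level 40, left associativity).

Lemma otimes_ten a b s : otimes a (ten b s) = ten a (b :: s).
Proof. exact: tcons_pure. Qed.

Lemma baxter_op_ten a s : baxter_op (ten a s) = ten 1 (a :: s).
Proof. exact: otimes_ten. Qed.

Lemma otimesP a c x y : otimes a (c *: x + y) = c *: otimes a x + otimes a y.
Proof. exact: linearP. Qed.

Lemma otimesD a x y : otimes a (x + y) = otimes a x + otimes a y.
Proof. exact: linearD. Qed.

Lemma otimesZ a c x : otimes a (c *: x) = c *: otimes a x.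
Proof. exact: linearZ. Qed.

Lemma otimes_linearl x : linear (otimes^~ x).
Proof. exact: tcons_linearl. Qed.

Lemma msh_mul_ten1 a b t : ten a [::] <.> ten b t = ten (a * b) t.
Proof. by rewrite /msh_mul diamond_pure /diamond_word; case: t. Qed.

Lemma msh_mul_ten2 a s b : ten a s <.> ten b [::] = ten (a * b) s.
Proof. by rewrite /msh_mul diamond_pure /diamond_word; case: s. Qed.

Lemma msh_mul_ten a0 a1 s b0 b1 t :
  ten a0 (a1 :: s) <.> ten b0 (b1 :: t) =
    otimes (a0 * b0) (ten a1 s <.> ten 1 (b1 :: t))
  + otimes (a0 * b0) (ten 1 (a1 :: s) <.> ten b1 t)
  + lam *: otimes (a0 * b0) (ten a1 s <.> ten b1 t).
Proof.
rewrite /msh_mul !diamond_pure -!linearZ -!linearD /=.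
rewrite {1}/diamond_word [size _]/= [size (_, _).2]/= addnS addSn dia_cons.
by rewrite !dia_fuel //= ?addnS.
Qed.

Lemma msh_linear_eq (V : lmodType C) (f g : Sha -> V) :
  linear f -> linear g -> (forall a s, f (ten a s) = g (ten a s)) -> f =1 g.
Proof. by move=> lf lg h; apply: linear_tens_eq => // -[a s]; exact: h. Qed.

Lemma msh_ind (Q : Sha -> Prop) :
  (forall c a s x, Q x -> Q (c *: ten a s + x)) -> Q 0 -> forall x, Q x.
Proof. by move=> h Q0; apply: tens_ind => // c [a s]; exact: h. Qed.

Lemma msh_mul_linearr x : linear (msh_mul x).
Proof. by move=> c u v; exact: (linearP (tlift _)). Qed.

Lemma msh_mul_linearl y : linear (msh_mul^~ y).
Proof.
move=> c u v; move: y; apply: msh_linear_eq => [d x y|d x y|a s].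
- exact: msh_mul_linearr.
- rewrite !msh_mul_linearr !scalerDr !scalerA [d * c]mulrC.
  by rewrite addrACA.
- by rewrite /msh_mul /diamond /ten !tlift_pure; exact: (linearP (tlift _)).
Qed.

Lemma msh_mulDl x y z : (x + y) <.> z = x <.> z + y <.> z.
Proof. by have := msh_mul_linearl z 1 x y; rewrite !scale1r. Qed.

Lemma msh_mulDr x y z : x <.> (y + z) = x <.> y + x <.> z.
Proof. by have := msh_mul_linearr x 1 y z; rewrite !scale1r. Qed.

Lemma msh_mul0l x : 0 <.> x = 0.
Proof. by apply: (addrI (0 <.> x)); rewrite -msh_mulDl !addr0. Qed.

Lemma msh_mul0r x : x <.> 0 = 0.
Proof. by apply: (addrI (x <.> 0)); rewrite -msh_mulDr !addr0. Qed.

Lemma msh_mulZl c x y : (c *: x) <.> y = c *: (x <.> y).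
Proof. by have := msh_mul_linearl y c x 0; rewrite !addr0 msh_mul0l addr0. Qed.

Lemma msh_mulZr c x y : x <.> (c *: y) = c *: (x <.> y).
Proof. by have := msh_mul_linearr x c y 0; rewrite !addr0 msh_mul0r addr0. Qed.

Lemma msh_mulC x y : x <.> y = y <.> x.
Proof.
move: y; apply: msh_linear_eq => [||b t]; first exact: msh_mul_linearr.
  exact: msh_mul_linearl.
move: x; apply: msh_linear_eq => [||a s]; first exact: msh_mul_linearl.
  exact: msh_mul_linearr.
by rewrite /msh_mul !diamond_pure /diamond_word diaC addnC.
Qed.

Lemma msh_mul1l a b x : ten a [::] <.> otimes b x = otimes (a * b) x.
Proof.
move: x; apply: msh_linear_eq => [c x y|c x y|d s].
- by rewrite linearP msh_mul_linearr.
- exact: linearP.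
- by rewrite !otimes_ten msh_mul_ten1.
Qed.

Lemma msh_mul_otimes a x b y :
  otimes a x <.> otimes b y =
  otimes (a * b) (x <.> baxter_op y + baxter_op x <.> y + lam *: (x <.> y)).
Proof.
elim/msh_ind: x => [c a1 s x IH|]; last first.
  by rewrite !linear0 !msh_mul0l scaler0 !addr0 linear0.
rewrite [otimes a _]otimesP [baxter_op (_ + _)]otimesP -!/(baxter_op _) !msh_mulDl !msh_mulZl {}IH.
suff -> : otimes a (ten a1 s) <.> otimes b y = otimes (a * b)
  (ten a1 s <.> baxter_op y + baxter_op (ten a1 s) <.> y + lam *: (ten a1 s <.> y)).
  rewrite -otimesP; congr (otimes _ _).
  rewrite !scalerDr !scalerA [c * lam]mulrC.
  by rewrite [LHS](AC (3*3) (1*4*(2*5)*(3*6)))%AC.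
elim/msh_ind: y => [d b1 t y IH|]; last first.
  by rewrite !linear0 !msh_mul0r scaler0 !addr0 linear0.
rewrite [otimes b (_ + _)]otimesP [baxter_op (_ + _)]otimesP -!/(baxter_op _).
rewrite !msh_mulDr !msh_mulZr {}IH baxter_op_ten !otimes_ten msh_mul_ten.
rewrite baxter_op_ten -!otimesZ -!otimesD.
rewrite -otimesP; congr (otimes _ _).
rewrite !scalerDr !scalerA [d * lam]mulrC.
by rewrite [LHS](AC (3*3) (1*4*(2*5)*(3*6)))%AC.
Qed.

Lemma msh_baxter x y : baxter_op x <.> baxter_op y =
  baxter_op (x <.> baxter_op y) + baxter_op (baxter_op x <.> y)
  + lam *: baxter_op (x <.> y).
Proof. by rewrite msh_mul_otimes mulr1 /baxter_op !otimesD otimesZ. Qed.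

Lemma msh_mul1A a x y : ten a [::] <.> (x <.> y) = (ten a [::] <.> x) <.> y.
Proof.
move: y; apply: msh_linear_eq => [c u v|c u v|b t].
- by rewrite !msh_mul_linearr.
- exact: msh_mul_linearr.
move: x; apply: msh_linear_eq => [c u v|c u v|d s].
- by rewrite msh_mul_linearl msh_mul_linearr.
- by rewrite msh_mul_linearr msh_mul_linearl.
case: s => [|d1 s]; first by rewrite !msh_mul_ten1 mulrA.
case: t => [|b1 t]; first by rewrite msh_mul_ten2 !msh_mul_ten1 msh_mul_ten2 mulrA.
rewrite msh_mul_ten1 -!otimes_ten !msh_mul_otimes msh_mul1l.
by rewrite mulrA.
Qed.

Lemma msh_mul1CA b x z : x <.> (ten b [::] <.> z) = ten b [::] <.> (x <.> z).
Proof. by rewrite msh_mulC -msh_mul1A [z <.> x]msh_mulC. Qed.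

Lemma msh_mulA_ten n a s b t c u : (size s + size t + size u < n)%N ->
  ten a s <.> (ten b t <.> ten c u) = (ten a s <.> ten b t) <.> ten c u.
Proof.
elim: n a s b t c u => // n IH a s b t c u; rewrite ltnS.
case: s => [|a1 s]; first by rewrite msh_mul1A.
case: t => [|b1 t].
  by rewrite msh_mul1CA [ten a _ <.> ten b _]msh_mulC msh_mul1A.
case: u => [|c1 u].
  by rewrite [ten b _ <.> ten c _]msh_mulC msh_mul1CA [RHS]msh_mulC.
rewrite /= !(addSn, addnS) => le_n.
set x := ten a1 s; set y := ten b1 t; set z := ten c1 u.
rewrite -!otimes_ten -/x -/y -/z !msh_mul_otimes mulrA; congr (otimes _ _).
have e1 : x <.> (baxter_op y <.> baxter_op z) = x <.> baxter_op y <.> baxter_op z.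
  by rewrite !baxter_op_ten IH //= !(addSn, addnS).
have e2 : baxter_op x <.> (y <.> baxter_op z) = baxter_op x <.> y <.> baxter_op z.
  by rewrite !baxter_op_ten IH //= !(addSn, addnS).
have e3 : baxter_op x <.> (baxter_op y <.> z) = baxter_op x <.> baxter_op y <.> z.
  by rewrite !baxter_op_ten IH //= !(addSn, addnS).
have e4 : baxter_op x <.> (y <.> z) = baxter_op x <.> y <.> z.
  by rewrite !baxter_op_ten IH //= !(addSn, addnS) ltnW.
have e5 : x <.> (baxter_op y <.> z) = x <.> baxter_op y <.> z.
  by rewrite !baxter_op_ten IH //= !(addSn, addnS) ltnW.
have e6 : x <.> (y <.> baxter_op z) = x <.> y <.> baxter_op z.
  by rewrite !baxter_op_ten IH //= !(addSn, addnS) ltnW.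
have e7 : x <.> (y <.> z) = x <.> y <.> z.
  by rewrite IH // ltnW // ltnW.
have PM v w : baxter_op (v <.> baxter_op w + baxter_op v <.> w + lam *: (v <.> w))
   = baxter_op v <.> baxter_op w by rewrite msh_mul_otimes mulr1.
rewrite !PM !msh_mulDr !msh_mulDl !msh_mulZr !msh_mulZl e1 e2 e3 e4 e5 e6 e7.
rewrite !scalerDr.
by rewrite [LHS](AC (1*3*3) (1*2*5*3*(6*4*7)))%AC.
Qed.

Lemma msh_mulA : associative msh_mul.
Proof.
move=> x y z; move: z; apply: msh_linear_eq => [k v w|k v w|c u].
- by rewrite !msh_mul_linearr.
- exact: msh_mul_linearr.
move: y; apply: msh_linear_eq => [k v w|k v w|b t].
- by rewrite msh_mul_linearl msh_mul_linearr.
- by rewrite msh_mul_linearr msh_mul_linearl.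
move: x; apply: msh_linear_eq => [k v w|k v w|a s].
- exact: msh_mul_linearl.
- by rewrite !msh_mul_linearl.
exact: msh_mulA_ten (ltnSn _).
Qed.

Lemma msh_mul1 : left_id (ten 1 [::]) msh_mul.
Proof.
apply: msh_linear_eq => [||a s]; [exact: msh_mul_linearr|by []|].
by rewrite msh_mul_ten1 mul1r.
Qed.

Lemma head_multilinear :
  multilinear (fun w : word A => if w.2 is [::] then w.1 else 0).
Proof.
split=> [c a b [|? s]|a0 [|? s] t c a b] //=; by rewrite scaler0 addr0.
Qed.

Lemma msh_one_neq0 : ten 1 [::] != 0.
Proof.
apply/eqP => /(congr1 (tlift head_multilinear)).
by rewrite linear0 tlift_pure /=; apply/eqP; exact: oner_neq0.
Qed.

HB.instance Definition _ := GRing.Zmodule_isComNzRing.Build Sha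
  msh_mulA msh_mulC msh_mul1 msh_mulDl msh_one_neq0.

Lemma msh_scalerAl (c : C) (x y : Sha) : c *: (x * y) = (c *: x) * y.
Proof. by rewrite [RHS]msh_mulZl. Qed.

HB.instance Definition _ := GRing.Lmodule_isLalgebra.Build C Sha msh_scalerAl.
HB.instance Definition _ := GRing.Lalgebra_isComAlgebra.Build C Sha.

End MixableShuffle.

Arguments ten {C A} lam a s.
Arguments baxter_op {C A lam} x.

(* P is a Baxter operator of weight lam on the C-algebra R. *)
Definition is_baxter (C : comNzRingType) (lam : C) (R : algType C)
    (P : R -> R) : Prop :=
  linear P /\
  forall x y, P x * P y = P (x * P y) + P (P x * y) + lam *: P (x * y).

Lemma baxter_op_is_baxter (C : comNzRingType) (A : comAlgType C) (lam : C) :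
  is_baxter lam (@baxter_op C A lam).
Proof. by split; [move=> c x y; exact: linearP|exact: msh_baxter]. Qed.

Section Coefs.
Variables (C : comNzRingType) (lam : C).
Local Notation Sha := (mshuffle {poly C} lam).

(* 1 (x) x^{i_1} (x) ... (x) x^{i_k} *)
Definition one_xpow (I : seq nat) : Sha := ten lam 1 [seq 'X^i | i <- I].

(* S is the family of the coefficients S(n, I) of (1 (x) x)^n, where I ranges
   over the nonempty sequences with |I| = n; see power_coefs_exists and
   power_coefs_unique. *)
Definition power_coefs (n : nat) (S : {fsfun seq nat -> C with 0}) : Prop :=
  (forall I, I \in finsupp S -> I != [::] /\ sumn I = n) /\
  ten lam 1 [:: 'X] ^+ n = \sum_(I <- finsupp S) S I *: one_xpow I.

Fixpoint tail_coef (s : seq {poly C}) (J : seq nat) : C :=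
  match s, J with
  | [::], [::] => 1
  | a :: s', j :: J' => a`_j * tail_coef s' J'
  | _, _ => 0
  end.

Definition word_coef (J : seq nat) (w : word {poly C}) : C^o :=
  w.1`_0 * tail_coef w.2 J.

Lemma word_coef_multilinear J : multilinear (word_coef J).
Proof.
have lin c a b s t K : tail_coef (s ++ (c *: a + b) :: t) K =
  c * tail_coef (s ++ a :: t) K + tail_coef (s ++ b :: t) K.
  elim: s K => [|d s IH] [|k K] /=; rewrite ?mulr0 ?addr0 //.
    by rewrite coefD coefZ mulrDl mulrA.
  by rewrite IH mulrDr !mulrA [_ * c]mulrC.
split=> [c a b s|a0 s t c a b]; rewrite /word_coef /=.
  by rewrite coefD coefZ mulrDl scalerAl.
by rewrite lin mulrDr [X in X + _]mulrCA.
Qed.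

Lemma word_coef_one_xpow I J :
  word_coef J (1, [seq 'X^i | i <- I]) = (I == J)%:R.
Proof.
rewrite /word_coef /= coefC eqxx mul1r.
elim: I J => [|i I IH] [|j J] //=.
rewrite IH coefXn eqseq_cons eq_sym.
by case: eqP => _; rewrite ?mul1r ?mul0r.
Qed.

Lemma power_coefs_unique n S S' :
  power_coefs n S -> power_coefs n S' -> S = S'.
Proof.
move=> [_ e] [_ e']; apply/fsfunP => J.
pose g : Sha -> C^o := tlift (word_coef_multilinear J).
have gE (T : {fsfun seq nat -> C with 0}) :
    g (\sum_(I <- finsupp T) T I *: one_xpow I) = T J.
  rewrite /g linear_sum /=.
  under eq_bigr => I _ do rewrite linearZ /= tlift_pure word_coef_one_xpow.
  have [JT|JT] := boolP (J \in finsupp T).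
    rewrite (big_fsetD1 J) //= eqxx big_seq big1 => [|I].
      by rewrite addr0 /GRing.scale /= mulr1.
    by rewrite !inE => /andP[/negPf -> _]; rewrite scaler0.
  rewrite fsfun_dflt // big_seq big1 // => I IT.
  have /negPf -> : I != J by apply: contraNneq JT => <-.
  by rewrite scaler0.
by rewrite -[LHS]gE -[RHS]gE -e -e'.
Qed.

Definition in_span (n : nat) (x : Sha) : Prop :=
  exists2 l : seq (C * seq nat),
    all (fun u => (u.2 != [::]) && (sumn u.2 == n)) l &
    x = \sum_(u <- l) u.1 *: one_xpow u.2.

Lemma in_span0 n : in_span n 0.
Proof. by exists [::]; rewrite ?big_nil. Qed.

Lemma in_spanD n x y : in_span n x -> in_span n y -> in_span n (x + y).
Proof.
move=> [l hl ->] [m hm ->]; exists (l ++ m); first by rewrite all_cat hl.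
by rewrite big_cat.
Qed.

Lemma in_spanZ n c x : in_span n x -> in_span n (c *: x).
Proof.
move=> [l hl ->]; exists [seq (c * u.1, u.2) | u <- l].
  by rewrite all_map.
rewrite big_map scaler_sumr; apply: eq_bigr => u _ /=.
by rewrite scalerA.
Qed.

Lemma in_span_one_xpow n I : I != [::] -> sumn I = n -> in_span n (one_xpow I).
Proof.
move=> I0 In; exists [:: (1, I)]; first by rewrite /= I0 In eqxx.
by rewrite big_seq1 scale1r.
Qed.

Lemma ten1_baxter (a : {poly C}) (x : Sha) :
  ten lam a [::] * baxter_op x = otimes a x.
Proof. by rewrite [LHS]msh_mul1l mulr1. Qed.

Lemma in_span_cons n i x :
  in_span n x -> in_span (i + n) (baxter_op (ten lam 'X^i [::] * x)).
Proof.
move=> [l /allP hl ->]; exists [seq (u.1, i :: u.2) | u <- l].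
  by apply/allP => _ /mapP[u /hl /andP[_ /eqP e] ->] /=; rewrite e.
rewrite mulr_sumr /baxter_op linear_sum big_map; apply: eq_bigr => u _ /=.
rewrite -scalerAr linearZ /=; congr (_ *: _).
by rewrite [X in otimes 1 X]msh_mul_ten1 mulr1 [LHS]otimes_ten.
Qed.

Lemma in_span_mulx I : in_span (sumn I).+1 (ten lam 1 [:: 'X] * one_xpow I).
Proof.
elim: I => [|i I IH].
  rewrite [X in in_span _ X](_ : _ = one_xpow [:: 1%N]).
    exact: in_span_one_xpow.
  by rewrite [LHS]msh_mul_ten2 mulr1.
have -> : ten lam 1 [:: 'X] = baxter_op (ten lam 'X [::]).
  by rewrite baxter_op_ten.
have -> : one_xpow (i :: I) = baxter_op (ten lam 'X^i [seq 'X^j | j <- I]).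
  by rewrite baxter_op_ten.
rewrite [X in in_span _ X]msh_baxter; apply: in_spanD; first apply: in_spanD.
- rewrite baxter_op_ten msh_mul_ten1 mulr1 baxter_op_ten.
  exact: (@in_span_one_xpow _ (1%N :: i :: I)).
- have -> : msh_mul (baxter_op (ten lam 'X [::]))
     (ten lam 'X^i [seq 'X^j | j <- I]) =
     ten lam 'X^i [::] * (ten lam 1 [:: 'X] * one_xpow I).
    rewrite mulrCA -baxter_op_ten; congr (_ * _).
    by rewrite [RHS]msh_mul_ten1 mulr1.
  by rewrite /= -addnS; exact: in_span_cons.
- apply: in_spanZ; rewrite msh_mul_ten1 -exprS baxter_op_ten.
  exact: (@in_span_one_xpow _ (i.+1 :: I)).
Qed.

Lemma in_span_pow n : in_span n.+1 (ten lam 1 [:: 'X] ^+ n.+1).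
Proof.
elim: n => [|n [l /allP hl e]].
  by rewrite expr1; exact: (@in_span_one_xpow _ [:: 1%N]).
rewrite exprS {}e mulr_sumr big_seq.
elim/big_ind: _ => [||u /hl /andP[_ /eqP eu]]; first exact: in_span0.
  exact: in_spanD.
by rewrite -scalerAr; apply: in_spanZ; rewrite -eu; exact: in_span_mulx.
Qed.

Lemma power_coefs_exists n : (0 < n)%N -> exists S, power_coefs n S.
Proof.
case: n => // n _; have [l /allP hl e] := in_span_pow n.
pose F := [fset I in [seq u.2 | u <- l]]%fset.
pose S : {fsfun seq nat -> C with 0} :=
  [fsfun I in F => \sum_(u <- l | u.2 == I) u.1 | 0].
have sF : (finsupp S `<=` F)%fset.
  by apply/fsubsetP => I; rewrite mem_finsupp fsfunE; case: ifP; rewrite ?eqxx.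
exists S; split.
  move=> I /(fsubsetP sF); rewrite !inE /= => /mapP[u /hl /andP[h /eqP k] ->].
  by [].
rewrite e (big_fset_incl _ sF) /=; last first.
  by move=> I _ /fsfun_dflt ->; rewrite scale0r.
under [RHS]eq_big_seq => I IF do rewrite fsfunE IF scaler_suml big_mkcond.
rewrite exchange_big /=; apply: eq_big_seq => u ul.
have uF : u.2 \in F by rewrite !inE /= map_f.
rewrite (big_fsetD1 u.2) //= eqxx big_seq big1 ?addr0 // => I.
by rewrite !inE eq_sym => /andP[/negPf -> _].
Qed.

End Coefs.

Definition falling (k : nat) : {poly int} := \prod_(j < k) ('X - j%:R%:P).

(* S2 n k are the Stirling numbers of the second kind, defined by
   t^n = \sum_(k <= n) S2 n k * t (t - 1) ... (t - k + 1). *)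
Definition stirling2_numbers (S2 : nat -> nat -> int) : Prop :=
  forall n, 'X^n = \sum_(k < n.+1) S2 n k *: falling k.

Lemma stirling2_numbers_exists : exists S2, stirling2_numbers S2.
Proof.
pose fix s n k {struct n} : int := match n, k with
  | 0, 0 => 1 | 0, _.+1 => 0 | n.+1, 0 => 0
  | n.+1, k.+1 => s n k + k.+1%:R * s n k.+1 end.
have s_gt n k : (n < k)%N -> s n k = 0.
  elim: n k => [|n IH] [|k] //= lt; rewrite !IH ?mulr0 //.
  exact: ltnW.
exists s; elim=> [|n IH].
  by rewrite big_ord1 /= scale1r /falling big_ord0 expr0.
have fS k : falling k * 'X = falling k.+1 + k%:R *: falling k.
  rewrite /falling big_ord_recr /= mulrBr -mul_polyC [_%:P * _]mulrC.
  by rewrite polyC_natr subrK.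
rewrite exprSr IH mulr_suml.
under eq_bigr => k _ do rewrite -scalerAl fS scalerDr scalerA mulrC.
rewrite big_split /= [RHS]big_ord_recl /= scale0r add0r.
under [RHS]eq_bigr => k _ do rewrite /bump add1n /= scalerDl.
rewrite big_split /=; congr (_ + _).
rewrite big_ord_recl mul0r scale0r add0r [RHS]big_ord_recr /=.
by rewrite s_gt // mulr0 scale0r addr0.
Qed.

Lemma stirling2_numbers_unique S2 S2' n k :
  stirling2_numbers S2 -> stirling2_numbers S2' -> (k <= n)%N ->
  S2 n k = S2' n k.
Proof.
have sz i : size (falling i) = i.+1.
  by rewrite size_prod_XsubC [index_enum _]unlock -enumT size_enum_ord.
have mon i : falling i \is monic by exact: monic_prod_XsubC.
have indep m (c : nat -> int) : \sum_(i < m) c i *: falling i = 0 ->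
    forall i, (i < m)%N -> c i = 0.
  elim: m => // m IH; rewrite big_ord_recr /= => e.
  have cm : c m = 0.
    have := congr1 (fun q : {poly int} => q`_m) e.
    have lm : (falling m)`_m = 1 by rewrite -(monicP (mon m)) lead_coefE sz.
    rewrite coefD coef0 coefZ lm mulr1 coef_sum big1 ?add0r // => i _.
    by rewrite coefZ nth_default ?mulr0 // sz.
  move: e; rewrite cm scale0r addr0 => /IH h i; rewrite ltnS leq_eqVlt.
  by case/predU1P => [->|/h].
move=> h h' kn; apply/eqP; rewrite -subr_eq0; apply/eqP.
apply: (indep n.+1 (fun i => S2 n i - S2' n i)) => //.
under eq_bigr => i _ do rewrite scalerBl.
by rewrite sumrB -h -h' subrr.
Qed.

(* Main.v *)
(**
  By the Baxter identity and Pascal's rule,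
    P(a)^n = \sum_(1 <= i <= n) 'C(n, i) lam^(i-1) P(a^i P(a)^(n-i))
  in every commutative Baxter algebra. For n = p the binomials with 0 < i < p
  vanish modulo p, which is (4). Taking a = x gives (3), and applying to (3)
  the linear form that reads off the coefficient of 1 (x) x^I gives (1). For
  (2), evaluate t^p = \sum_k S(p, k) t(t-1)...(t-k+1) at t = 0, ..., p-1 in
  F_p, where t^p = t. For (5), if lam is nonzero then lam^(p-1) = 1 and the
  p-th power map is additive and fixes words, by (4) and induction on their
  length; if lam = 0 then (4) gives P(b)^p = 0.
*)
From HB Require Import structures.
Require Import Defs.
From mathcomp Require Import all_boot all_order all_algebra all_field.
From mathcomp Require Import finmap.

Set Implicit Arguments.
Unset Strict Implicit.
Unset Printing Implicit Defensive.

Import GRing.Theory.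
Local Open Scope ring_scope.

Section BaxterPowers.
Variables (C : comNzRingType) (lam : C) (R : comAlgType C) (P : R -> R).
Hypothesis baxP : is_baxter lam P.

(** Induction on [n]: multiplying each summand by P(a) and applying the Baxter identity gives one
    nested term and two neighbouring terms [T i] and [T i.+1]. *)
Lemma baxter_expr (a : R) (n : nat) :
  P a ^+ n.+1 = \sum_(i < n.+1)
     ('C(n.+1, i.+1)%:R * lam ^+ i) *: P (a ^+ i.+1 * P a ^+ (n - i)).
Proof.
have [_ bax] := baxP.
pose PL : {linear R -> R} := HB.pack P (GRing.isLinear.Build _ _ _ _ P baxP.1).
have PZ c x : P (c *: x) = c *: P x := linearZ_LR PL c x.
have Psum m (F : 'I_m -> R) : P (\sum_i F i) = \sum_i P (F i) :=
  raddf_sum PL _ _ _.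
elim: n => [|n IH].
  by rewrite big_ord1 binn expr0 mulr1 scale1r !expr1 subnn expr0 mulr1.
pose T i := P (a ^+ i.+1 * P a ^+ (n.+1 - i)).
have step (i : 'I_n.+1) : P a * P (a ^+ i.+1 * P a ^+ (n - i)) =
    P (a * P (a ^+ i.+1 * P a ^+ (n - i))) + T i + lam *: T i.+1.
  rewrite bax /T; congr (P _ + P _ + lam *: P _).
    by rewrite mulrCA -exprS subSn // -ltnS.
  by rewrite mulrA -exprS subSS.
rewrite exprS {1}IH mulr_sumr.
under eq_bigr => i _ do rewrite -scalerAr step -addrA scalerDr.
rewrite big_split /=.
(* By linearity, [IH] read backwards collapses the nested terms to P(a P(a)^(n+1)). *)
have -> : \sum_(i < n.+1) ('C(n.+1, i.+1)%:R * lam ^+ i) *: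
     P (a * P (a ^+ i.+1 * P a ^+ (n - i))) = T 0%N.
  rewrite /T expr1 subn0 IH mulr_sumr Psum.
  by apply: eq_bigr => i _; rewrite -scalerAr PZ.
under eq_bigr => i _ do rewrite scalerDr scalerA.
(* The ends are matched separately: [T 0] has coefficient 1 + (n+1), and [T n.+1] comes only from
   the shifted sum. Pascal's rule handles the rest. *)
rewrite big_split /= big_ord_recl /= [X in _ + (_ + X)]big_ord_recr /=.
rewrite -[RHS]/(\sum_(i < n.+2) ('C(n.+2, i.+1)%:R * lam ^+ i) *: T i).
rewrite [RHS]big_ord_recl [X in _ = _ + X]big_ord_recr /= /bump /= !add1n.
rewrite !expr0 !mulr1 !bin1 !binn !mul1r -exprSr.
rewrite -[in RHS]natr1 scalerDl scale1r [X in _ = X + _]addrC -!addrA.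
do 2 congr (_ + _).
rewrite addrA; congr (_ + _); rewrite -big_split /=; apply: eq_bigr => i _.
by rewrite !add1n [in RHS]binS natrD mulrDl scalerDl -mulrA -exprSr.
Qed.

Lemma baxter_exp_prime (p : nat) (p_prime : prime p) (a : R) :
  eqmodr p (P a ^+ p) (lam ^+ p.-1 *: P (a ^+ p)).
Proof.
case: p p_prime => // n p_prime /=.
(* Here p = n+1. The summand i = n is the right-hand side; dividing the other binomials by p gives
   the witness. *)
rewrite /eqmodr baxter_expr big_ord_recr /= binn mul1r subnn expr0 mulr1 addrK.
exists (\sum_(i < n) (('C(n.+1, i.+1) %/ n.+1)%:R * lam ^+ i) *:
    P (a ^+ i.+1 * P a ^+ (n - i))).
rewrite mulr_sumr; apply: eq_bigr => i _.
have /divnK {1}<- : (n.+1 %| 'C(n.+1, i.+1))%N.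
  by apply: prime_dvd_bin; rewrite //= !ltnS.
by rewrite [RHS]mulr_natl -[RHS]scaler_nat scalerA natrM [_ * n.+1%:R]mulrC mulrA.
Qed.

End BaxterPowers.

Section Words.
Variables (C : comNzRingType) (A : comAlgType C) (lam : C).

Lemma ten_scale (c : C) (a : A) (s : seq A) :
  ten lam (c *: a) s = c *: ten lam a s.
Proof.
have [h _] := @pure_multilinear C A; have := h c a 0 s.
(* Multilinearity at [1 *: 0 + 0] reads z = z + z. *)
have z : ten lam 0 s = 0.
  by have := h 1 0 0 s; rewrite !scale1r addr0 => /(canLR (addrK _)) /esym; rewrite subrr.
by rewrite addr0 => e; rewrite [LHS]e [X in _ + X]z addr0.
Qed.

Lemma ten_exp (a : A) (n : nat) : ten lam a [::] ^+ n = ten lam (a ^+ n) [::].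
Proof.
by elim: n => // n IH; rewrite exprS IH [LHS]msh_mul_ten1 -exprS.
Qed.

Lemma baxter_op_exp_prime (p : nat) (x : mshuffle A lam) : prime p ->
  eqmodr p (baxter_op x ^+ p) (lam ^+ p.-1 *: baxter_op (x ^+ p)).
Proof.
move=> p_prime.
exact: (baxter_exp_prime (baxter_op_is_baxter A lam) p_prime x).
Qed.

End Words.

Section Coefficients.
Variables (C : comNzRingType) (lam : C).

Lemma ten1X_exp_prime (p : nat) : prime p ->
  eqmodr p (ten lam 1 [:: 'X] ^+ p) (ten lam (lam ^+ p.-1)%:P [:: 'X^p]).
Proof.
move/(baxter_op_exp_prime (ten lam ('X : {poly C}) [::])).
by rewrite ten_exp !baxter_op_ten -ten_scale alg_polyC.
Qed.

(** The form dual to [one_xpow J]: it is 1 on that basis vector and 0 on the other [one_xpow I]. *)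
Definition coef_form (J : seq nat) : mshuffle {poly C} lam -> C^o :=
  tlift (word_coef_multilinear C J).
HB.instance Definition _ J := GRing.Linear.on (coef_form J).

Lemma coef_form_power_coefs n (S : {fsfun seq nat -> C with 0}) J :
  power_coefs lam n S -> coef_form J (ten lam 1 [:: 'X] ^+ n) = S J.
Proof.
move=> [_ ->]; rewrite linear_sum /=.
under eq_bigr => I _ do
  rewrite linearZ /= [coef_form _ _]tlift_pure word_coef_one_xpow.
have [JS|JS] := boolP (J \in finsupp S).
  rewrite (big_fsetD1 J) //= eqxx big_seq big1 => [|I].
    by rewrite addr0 /GRing.scale /= mulr1.
  by rewrite !inE => /andP[/negPf -> _]; rewrite scaler0.
(* Off the support, [S J] is the default value 0 and no summand has index [J]. *)
rewrite fsfun_dflt // big_seq big1 // => I IS.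
have /negPf -> : I != J by apply: contraNneq JS => <-.
by rewrite scaler0.
Qed.

Lemma power_coefs_dvd (p : nat) (S : {fsfun seq nat -> C with 0}) (I : seq nat) :
  prime p -> power_coefs lam p S -> I != [:: p] -> dvdr p (S I).
Proof.
move=> p_prime hS; rewrite eq_sym => /negPf Ip.
have [d /(congr1 (coef_form I))] := ten1X_exp_prime p_prime.
rewrite linearB /= (coef_form_power_coefs _ hS) -alg_polyC ten_scale.
(* The form kills 1 (x) x^p because [I] differs from (p), and sends the multiple p d to a multiple
   of p. *)
rewrite linearZ /= [coef_form I (ten _ _ _)](_ : _ = 0).
  rewrite scaler0 subr0 mulr_natl raddfMn /= => ->.
  by exists (coef_form I d); rewrite mulr_natl.
by rewrite [LHS]tlift_pure [LHS](word_coef_one_xpow C [:: p]) Ip.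
Qed.

End Coefficients.

Lemma falling_horner (k t : nat) : (falling k).[t%:R] = (t ^_ k)%:R.
Proof.
elim: k => [|k IH]; first by rewrite /falling big_ord0 hornerC.
rewrite /falling big_ord_recr hornerM -/(falling k) IH ffactnSr natrM.
(* For t < k truncated subtraction would be wrong, but the factor [t ^_ k] is already 0. *)
rewrite hornerXsubC; have [le_kt|lt_tk] := leqP k t; first by rewrite natrB.
by rewrite ffact_small ?mul0r.
Qed.

Lemma prime_dvd_fact (p n : nat) : prime p -> (p %| n`!)%N = (p <= n)%N.
Proof.
move=> p_prime; apply/idP/idP => [|le_pn]; last by rewrite dvdn_fact ?prime_gt0.
elim: n => [|n IH]; first by rewrite Euclid_dvd1.
by rewrite factS Euclid_dvdM // => /orP[/dvdn_leq->//|/IH/leqW].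
Qed.

Lemma Fp_exp_prime (p : nat) (c : 'F_p) : prime p -> c ^+ p = c.
Proof. by move=> /card_Fp {3}<-; exact: expf_card. Qed.

Lemma Fp_exp_pred_prime (p : nat) (c : 'F_p) :
  prime p -> c != 0 -> c ^+ p.-1 = 1.
Proof.
move=> p_prime c0; apply: (mulfI c0).
by rewrite -exprS prednK ?prime_gt0 // mulr1 Fp_exp_prime.
Qed.

Lemma stirling2_prime (S2 : nat -> nat -> int) (p k : nat) :
  prime p -> stirling2_numbers S2 -> (1 < k < p)%N -> (p %| S2 p k)%Z.
Proof.
move=> p_prime hS /andP[k_gt1 lt_kp].
(* In F_p, t^p = t is the falling factorial of length 1, so [s] collects the coefficients of the
   zero function. *)
pose s i : 'F_p := (S2 p i)%:~R - (i == 1)%:R.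
have Fnat_eq0 m : ((m%:R : 'F_p) == 0) = (p %| m)%N.
  exact/esym/dvdn_pcharf/pchar_Fp.
have sumE t : \sum_(i < p.+1) s i * (t ^_ i)%:R = 0.
  have /(congr1 (fun q => q.[t%:R]%:~R : 'F_p)) := hS p.
  rewrite hornerXn rmorphXn /= rmorph_nat Fp_exp_prime //.
  rewrite horner_sum rmorph_sum /= => e.
  under eq_bigr => i _ do rewrite mulrBl.
  rewrite sumrB [X in _ - X](_ : _ = t%:R).
    rewrite e; apply/eqP; rewrite subr_eq0; apply/eqP/eq_bigr => i _.
    by rewrite hornerZ falling_horner rmorphM /= rmorph_nat.
  have lt1p : (1 < p.+1)%N by rewrite ltnS prime_gt0.
  rewrite (bigD1 (Ordinal lt1p)) //= mul1r ffactn1 big1 ?addr0 // => i ne.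
  by rewrite -[i == 1 :> nat]/(i == Ordinal lt1p) (negPf ne) mul0r.
(* The system is triangular: at t = m the terms i > m vanish, those with i < m vanish by induction,
   and m! is invertible as m < p. *)
have s0 : forall m, (m < p)%N -> s m = 0.
  elim/ltn_ind=> m IH lt_mp; have := sumE m.
  rewrite (bigD1 (Ordinal (ltnW lt_mp : (m < p.+1)%N))) //= big1 => [|i ne].
    rewrite addr0 ffactnn => /eqP; rewrite mulf_eq0 => /predU1P[//|].
    by rewrite Fnat_eq0 prime_dvd_fact // leqNgt lt_mp.
  have [lt_im|lt_mi|e] := ltngtP i m.
  - by rewrite IH ?mul0r // (ltn_trans lt_im).
  - by rewrite ffact_small ?mulr0.
  - by rewrite -val_eqE /= e eqxx in ne.
have := s0 k lt_kp; rewrite /s gtn_eqF // subr0 => /eqP.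
rewrite dvdzE /= -Fnat_eq0; case: (S2 p k) => m /=; first by rewrite pmulrn.
by rewrite NegzE mulrNz oppr_eq0 -pmulrn.
Qed.

Section PrimeField.
Variables (p : nat) (p_prime : prime p) (mu : 'F_p).
Local Notation Sha := (mshuffle ('F_p)^o mu).

Lemma natp_msh_eq0 : p%:R = 0 :> Sha.
Proof. by rewrite -scaler_nat pchar_Fp_0 // scale0r. Qed.

Lemma baxter_op_exp_Fp (x : Sha) :
  baxter_op x ^+ p = mu ^+ p.-1 *: baxter_op (x ^+ p).
Proof.
have [d e] := baxter_op_exp_prime x p_prime.
by apply/eqP; rewrite -subr_eq0 e natp_msh_eq0 mul0r.
Qed.

Lemma msh_exp_Fp (x : Sha) : mu != 0 -> x ^+ p = x.
Proof.
move=> mu0.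
(* Over the base F_p every word is a scalar times a word starting with 1; if longer than one letter,
   the latter is a value of [baxter_op]. *)
have tenE (a : ('F_p)^o) s : ten mu a s = (a : 'F_p) *: ten mu 1 s.
  by rewrite -ten_scale /GRing.scale /= mulr1.
have pchSha : p \in [pchar Sha].
  by rewrite inE /= p_prime natp_msh_eq0 eqxx.
elim/msh_ind: x => [c a s x IH|]; last by rewrite expr0n gtn_eqF ?prime_gt0.
(* Additivity of Frobenius reduces the claim to single words. *)
rewrite -!(pFrobenius_autE pchSha) pFrobenius_autD_comm; last exact: mulrC.
rewrite !pFrobenius_autE IH exprZn Fp_exp_prime //; congr (_ *: _ + _).
elim: s a {c x IH} => [|b s IH] a; first by rewrite ten_exp Fp_exp_prime.
rewrite tenE exprZn Fp_exp_prime // -baxter_op_ten baxter_op_exp_Fp IH.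
by rewrite Fp_exp_pred_prime // scale1r.
Qed.

End PrimeField.

Theorem proposition3p3 (p : nat) (p_prime : prime p)
    (C : comNzRingType) (lam : C) :
  (forall S : {fsfun seq nat -> C with 0}, power_coefs lam p S ->
     forall I : seq nat, I != [::] -> sumn I = p -> I != [:: p] ->
       dvdr p (S I)) /\
  (forall S2 : nat -> nat -> int, stirling2_numbers S2 ->
     forall k : nat, (1 < k < p)%N -> (p %| S2 p k)%Z) /\
  eqmodr p ((ten lam 1 [:: 'X]) ^+ p)
           (ten lam (lam ^+ p.-1)%:P [:: 'X^p]) /\
  (forall (R : comAlgType C) (P : R -> R), is_baxter lam P ->
     forall a : R, eqmodr p (P a ^+ p) (lam ^+ p.-1 *: P (a ^+ p))) /\
  (forall mu : 'F_p, mu ^+ p.-1 = mu ->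
     forall a : mshuffle ('F_p)^o mu,
       (* without this, false for mu = 0 and a = 1 *)
       mu != 0 \/ (exists b : mshuffle ('F_p)^o mu, a = baxter_op b) ->
       a ^+ p = mu ^+ p.-1 *: a).
Proof.
split; first by move=> S hS I _ _; exact: power_coefs_dvd p_prime hS.
split; first by move=> S2 hS k; exact: stirling2_prime p_prime hS.
split; first exact: ten1X_exp_prime.
split; first by move=> R P baxP a; exact: baxter_exp_prime.
move=> mu mu_exp a; have [mu0 [|[b ->]]|mu0 _] := eqVneq mu 0.
- by [].
(* Both sides are 0, since mu^(p-1) = mu = 0. *)
- by rewrite baxter_op_exp_Fp // mu_exp mu0 !scale0r.
- by rewrite msh_exp_Fp // Fp_exp_pred_prime // scale1r.
Qed.
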